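(* In the setting of the dilute $A_6$ model described in the context (largest-eigenvalue sector, with its standing assumptions), the functions $T^{(1)},\dots,T^{(6)}$ satisfy, as identities of meromorphic functions of $x\in\mathbb C$, $$\begin{aligned} T^{(1)}(x-\tfrac14 i)\,T^{(1)}(x+\tfrac14 i)&=T_0(x)+T^{(2)}(x),\\ T^{(5)}(x-\tfrac14 i)\,T^{(5)}(x+\tfrac14 i)&=T_0(x)+T^{(4)}(x),\\ T^{(6)}(x-\tfrac14 i)\,T^{(6)}(x+\tfrac14 i)&=T_0(x\pm\tfrac34 i)+\phi(x+\tfrac74 i)\,T^{(3)}(x),\\ T^{(2)}(x-\tfrac14 i)\,T^{(2)}(x+\tfrac14 i)&=T_0(x\pm\tfrac14 i)+T^{(1)}(x)\,T^{(3)}(x),\\ T^{(3)}(x-\tfrac14 i)\,T^{(3)}(x+\tfrac14 i)&=T_0(x)\,T_0(x\pm\tfrac12 i)+\big(T^{(2)}(x)\big)^2\,T^{(6)}(x),\\ T^{(4)}(x-\tfrac14 i)\,T^{(4)}(x+\tfrac14 i)&=T_0(x\pm\tfrac14 i)+T^{(3)}(x)\,T^{(5)}(x). \end{aligned}$$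
   Context: Convention: $f(x\pm iy):=f(x+iy)f(x-iy)$. Basic functions (dilute $A_6$ model). Put $\eta=\frac{2\pi}{7}$, fix $\tau>0$, $q=e^{-\tau}$, $\vartheta_1(z)=2q^{1/4}\sin z\prod_{n\ge1}(1-2q^{2n}\cos 2z+q^{4n})(1-q^{2n})$, and $h[x]=\vartheta_1(i\eta x)$. Let $N$ be a positive even integer, $u$ a real parameter, $w=e^{i\pi/7}$, $$\phi(x)=\Big(\frac{h[x+(\frac32-u)i]\,h[x-(\frac32-u)i]}{h[2i]\,h[3i]}\Big)^{N/2},\qquad Q(x)=\prod_{j=1}^N h[x-x_j].$$ Both $\phi$ and $Q$ have period $\frac{7}{2}i$. The complex numbers $x_1,\dots,x_N$ solve the Bethe ansatz equations $w\frac{\phi(x_j+i)}{\phi(x_j-i)}=-\frac{Q(x_j-i)Q(x_j+2i)}{Q(x_j+i)Q(x_j-2i)}$, $j=1,\dots,N$. Boxes: $b_1(x)=w\,\phi(x+\frac32 i)\phi(x+\frac12 i)\frac{Q(x-\frac52 i)}{Q(x-\frac12 i)}$, $b_2(x)=\phi(x+\frac32 i)\phi(x-\frac32 i)\frac{Q(x-\frac32 i)Q(x+\frac32 i)}{Q(x-\frac12 i)Q(x+\frac12 i)}$, $b_3(x)=w^{-1}\phi(x-\frac32 i)\phi(x-\frac12 i)\frac{Q(x+\frac52 i)}{Q(x+\frac12 i)}$. One-row functions: for $m\ge1$, $f_m(x)=\prod_{j=1}^{m-1}\phi(x\pm i(\frac{2m-1}{2}-j))$ and $$T_m(x)=\frac1{f_m(x)}\sum_{1\le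 i_1\le\cdots\le i_m\le3}\ \prod_{k=1}^m b_{i_k}\big(x+i(2k-1-m)\big);$$ $T_0(x)=\phi(x\pm\frac12 i)$ and $T_m=0$ for $m<0$. Standing assumptions (largest-eigenvalue sector): $T_m(x)=T_{11-m}(x)$ for $0\le m\le 11$; $T_{12}=T_{13}=0$; $T_{m+14}(x)=T_m(x)$ for $m\ge-1$; and $Q(x)=\overline{Q(\bar x)}$. Definitions of $T^{(a)}$: $T^{(6)}(x)=T_1(x)$; $$\begin{aligned}T^{(1)}(x)=T^{(5)}(x)=\tfrac12\Big(&w^3\phi(x+\tfrac34 i)\tfrac{Q(x+\frac34 i)}{Q(x-\frac14 i)}+w^2\phi(x-\tfrac54 i)\tfrac{Q(x-\frac54 i)Q(x-\frac74 i)}{Q(x-\frac14 i)Q(x+\frac54 i)}+w\,\phi(x+\tfrac14 i)\tfrac{Q(x+\frac14 i)Q(x-\frac74 i)}{Q(x-\frac34 i)Q(x+\frac54 i)}\\ &+\phi(x-\tfrac74 i)\tfrac{Q(x-\frac74 i)^2}{Q(x-\frac34 i)Q(x+\frac34 i)}+w^{-1}\phi(x-\tfrac14 i)\tfrac{Q(x-\frac14 i)Q(x+\frac74 i)}{Q(x+\frac34 i)Q(x-\frac54 i)}\\ &+w^{-2}\phi(x+\tfrac54 i)\tfrac{Q(x+\frac54 i)Q(x+\frac74 i)}{Q(x+\frac14 i)Q(x-\frac54 i)}+w^{-3}\phi(x-\tfrac34 i)\tfrac{Q(x-\frac34 i)}{Q(x+\frac14 i)}\Big);\end{aligned}$$ $T^{(2)}(x)=T^{(4)}(x)=T^{(1)}(x-\frac14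 i)T^{(1)}(x+\frac14 i)-T_0(x)$; $T^{(3)}(x)=\frac{1}{\phi(x+\frac74 i)}\big(T_1(x-\frac14 i)T_1(x+\frac14 i)-T_0(x\pm\frac34 i)\big)$. *)

(* Defs.v *)
From mathcomp Require Export all_boot all_order all_algebra.
From mathcomp Require Export complex.
From mathcomp Require Export all_classical all_reals all_analysis.
Set Implicit Arguments.
Unset Strict Implicit.
Unset Printing Implicit Defensive.
Export Order.TTheory GRing.Theory Num.Theory.
Export numFieldNormedType.Exports.

Local Open Scope classical_set_scope.
Local Open Scope ring_scope.
Local Open Scope complex_scope.

(* Meromorphic functions are represented by total functions on [R[i]] whose
   values at the poles are meaningless (division by 0 yields 0).  Two such
   functions are the same meromorphic function iff they agree off a closed
   discrete set, i.e. on a punctured neighbourhood of every point.  The cast to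
   [numFieldType] selects the topology of [R[i]] given by the modulus. *)
Definition mero_eq (R : realType) (f g : R[i] -> R[i]) : Prop :=
  forall c : (R[i] : numFieldType), \forall x \near c^', f x = g x.

(* [f (x ± iy)].  ['i%C] is the explicit imaginary unit [0 +i* 1] of [R[i]]; the
   unqualified ['i] may be read in [ring_scope] as the generic imaginary unit of
   a [numClosedFieldType], which need not be convertible to it. *)
Definition pm (R : realType) (f : R[i] -> R[i]) (x y : R[i]) : R[i] :=
  f (x + 'i%C * y) * f (x - 'i%C * y).

Definition cexp (R : realType) (z : R[i]) : R[i] :=
  (expR (complex.Re z))%:C * (cos (complex.Im z) +i* sin (complex.Im z)).

Definition csin (R : realType) (z : R[i]) : R[i] :=
  (cexp ('i%C * z) - cexp (- ('i%C * z))) / (2 * 'i%C).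

Definition ccos (R : realType) (z : R[i]) : R[i] :=
  (cexp ('i%C * z) + cexp (- ('i%C * z))) / 2.

Definition nome (R : realType) (tau : R) : R := expR (- tau).

Definition theta1_factor (R : realType) (tau : R) (z : R[i]) (n : nat) : R[i] :=
  let q := (nome tau)%:C in
  (1 - 2 * q ^+ (2 * n) * ccos (2 * z) + q ^+ (4 * n)) * (1 - q ^+ (2 * n)).

Definition theta1 (R : realType) (tau : R) (z : R[i]) : R[i] :=
  2 * (nome tau `^ (4^-1))%:C * csin z *
  lim ((fun n : nat =>
          \prod_(1 <= k < n.+1) theta1_factor tau z k : (R[i] : numFieldType))
       @ \oo).

Definition eta (R : realType) : R := 2 * pi / 7.

Definition h (R : realType) (tau : R) (x : R[i]) : R[i] :=
  theta1 tau ('i%C * (eta R)%:C * x).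

Definition w (R : realType) : R[i] := cexp ('i%C * (pi / 7)%:C).

Definition phi_fun (R : realType) (tau u : R) (N : nat) (x : R[i]) : R[i] :=
  (h tau (x + (3 / 2 - u%:C) * 'i%C) * h tau (x - (3 / 2 - u%:C) * 'i%C)
     / (h tau (2 * 'i%C) * h tau (3 * 'i%C))) ^+ N./2.

Definition Q_fun (R : realType) (tau : R) (N : nat) (xs : 'I_N -> R[i])
    (x : R[i]) : R[i] :=
  \prod_(j < N) h tau (x - xs j).

(* The equations are between fractions, hence the non-vanishing of the
   denominators is part of them. *)
Definition bethe_equations (R : realType) (phi Q : R[i] -> R[i]) (N : nat)
    (xs : 'I_N -> R[i]) : Prop :=
  forall j : 'I_N,
    [/\ phi (xs j - 'i%C) != 0,
        Q (xs j + 'i%C) * Q (xs j - 2 * 'i%C) != 0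
      & w R * (phi (xs j + 'i%C) / phi (xs j - 'i%C)) =
        - (Q (xs j - 'i%C) * Q (xs j + 2 * 'i%C)
             / (Q (xs j + 'i%C) * Q (xs j - 2 * 'i%C)))].

Section Transfer.
Variables (R : realType) (phi Q : R[i] -> R[i]).
Implicit Types x : R[i].

Definition b1 x : R[i] :=
  w R * phi (x + 3 / 2 * 'i%C) * phi (x + 1 / 2 * 'i%C)
    * (Q (x - 5 / 2 * 'i%C) / Q (x - 1 / 2 * 'i%C)).

Definition b2 x : R[i] :=
  phi (x + 3 / 2 * 'i%C) * phi (x - 3 / 2 * 'i%C)
    * (Q (x - 3 / 2 * 'i%C) * Q (x + 3 / 2 * 'i%C)
         / (Q (x - 1 / 2 * 'i%C) * Q (x + 1 / 2 * 'i%C))).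

Definition b3 x : R[i] :=
  (w R)^-1 * phi (x - 3 / 2 * 'i%C) * phi (x - 1 / 2 * 'i%C)
    * (Q (x + 5 / 2 * 'i%C) / Q (x + 1 / 2 * 'i%C)).

(* Box labels are shifted by one: [i : 'I_3] stands for the label [i + 1]. *)
Definition box (i : 'I_3) : R[i] -> R[i] := nth b1 [:: b1; b2; b3] i.

Definition fnorm (m : nat) x : R[i] :=
  \prod_(1 <= j < m) pm phi x ((2 * m%:R - 1) / 2 - j%:R).

(* The tuple position [k < m] is the 1-based position [k + 1], so the shift
   [2(k+1) - 1 - m] reads [2k + 1 - m]. *)
Definition Tpos (m : nat) x : R[i] :=
  (fnorm m x)^-1 *
  \sum_(t : m.-tuple 'I_3 | sorted leq (map val t))
    \prod_(k < m) box (tnth t k) (x + 'i%C * (2 * k%:R + 1 - m%:R)).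

Definition T (m : int) x : R[i] :=
  match m with
  | Negz _ => 0
  | Posz 0 => pm phi x (1 / 2)
  | Posz n => Tpos n x
  end.

Definition TE1 x : R[i] :=
  1 / 2 *
  (w R ^+ 3 * phi (x + 3 / 4 * 'i%C)
     * (Q (x + 3 / 4 * 'i%C) / Q (x - 1 / 4 * 'i%C))
   + w R ^+ 2 * phi (x - 5 / 4 * 'i%C)
     * (Q (x - 5 / 4 * 'i%C) * Q (x - 7 / 4 * 'i%C)
          / (Q (x - 1 / 4 * 'i%C) * Q (x + 5 / 4 * 'i%C)))
   + w R * phi (x + 1 / 4 * 'i%C)
     * (Q (x + 1 / 4 * 'i%C) * Q (x - 7 / 4 * 'i%C)
          / (Q (x - 3 / 4 * 'i%C) * Q (x + 5 / 4 * 'i%C)))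
   + phi (x - 7 / 4 * 'i%C)
     * (Q (x - 7 / 4 * 'i%C) ^+ 2
          / (Q (x - 3 / 4 * 'i%C) * Q (x + 3 / 4 * 'i%C)))
   + w R ^- 1 * phi (x - 1 / 4 * 'i%C)
     * (Q (x - 1 / 4 * 'i%C) * Q (x + 7 / 4 * 'i%C)
          / (Q (x + 3 / 4 * 'i%C) * Q (x - 5 / 4 * 'i%C)))
   + w R ^- 2 * phi (x + 5 / 4 * 'i%C)
     * (Q (x + 5 / 4 * 'i%C) * Q (x + 7 / 4 * 'i%C)
          / (Q (x + 1 / 4 * 'i%C) * Q (x - 5 / 4 * 'i%C)))
   + w R ^- 3 * phi (x - 3 / 4 * 'i%C)
     * (Q (x - 3 / 4 * 'i%C) / Q (x + 1 / 4 * 'i%C))).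

Definition TE2 x : R[i] :=
  TE1 (x - 1 / 4 * 'i%C) * TE1 (x + 1 / 4 * 'i%C) - T 0 x.

Definition TE3 x : R[i] :=
  (phi (x + 7 / 4 * 'i%C))^-1 *
  (T 1 (x - 1 / 4 * 'i%C) * T 1 (x + 1 / 4 * 'i%C) - pm (T 0) x (3 / 4)).

Definition TE4 x : R[i] := TE2 x.

Definition TE5 x : R[i] := TE1 x.

Definition TE6 x : R[i] := T 1 x.

(* The equalities between the [T m] are equalities of meromorphic functions;
   [Q] is entire, so its reality is required at every point. *)
Definition largest_eigenvalue_sector : Prop :=
  [/\ (forall m : int, 0 <= m <= 11 -> mero_eq (T m) (T (11 - m))),
      mero_eq (T 12) (fun=> 0),
      mero_eq (T 13) (fun=> 0),
      (forall m : int, -1 <= m -> mero_eq (T (m + 14)) (T m))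
    & (forall x, Q x = (Q (x^*)%C)^*%C)].

End Transfer.

(* Main.v *)
Require Import Defs.
From mathcomp Require Import ring lra.
Set Implicit Arguments.
Unset Strict Implicit.
Unset Printing Implicit Defensive.
Import ComplexField.Normc.
Local Open Scope classical_set_scope.
Local Open Scope ring_scope.
Local Open Scope complex_scope.

(** Fix a generic point x and write F_k for F(x + k i/4); [phi] and [Q] then
    have period 14 in k.  The seven terms of T^(1) form a geometric sum, so that
      w^3 phi_k Q_k = Q_(k-4) T^(1)_(k-3) - w^-1 Q_(k+4) T^(1)_(k+3).
    Hence, after the gauge Q_(8n) = w^n q_n, there is a sequence z with
    z_(n+7) = - z_n for which
      T^(1)_(8n+3) = z_n q_(n+3),
      phi_(8n) = (z_(n+1) - z_n) q_(n+3) q_(n+4) / q_n.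
    All the boxes of T_m telescope, T_m being a double sum over the positions of
    the two label changes, and T_6 - T_5 turns out to be a nonzero multiple of
    the quadratic form sum_(n mod 7) z_n z_(n+3).  The symmetry T_5 = T_6
    therefore kills this form, and the fusion relations are polynomial identities
    in the z_n modulo it.  The divisions are legitimate off a discrete set since
    the zeros of theta_1 are isolated, which follows from the convergence of its
    product. *)

(** * Row sums *)

Section RowSum.
Variables (K : comNzRingType) (X : Type) (step : X -> X) (b : 'I_3 -> X -> K).

(** A form of the sum over weakly increasing tuples suited to induction on the row length: the first
    box is chosen, and [i] is the least label still allowed. *)
Fixpoint row_sum (m i : nat) (x : X) : K :=
  if m is m'.+1 then \sum_(j < 3 | (i <= j)%N) b j x * row_sum m' j (step x)
  else 1.

Lemma row_sumE m i x :
  \sum_(t : m.-tuple 'I_3 | path leq i (map val t))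
    \prod_(k < m) b (tnth t k) (iter k step x) = row_sum m i x.
Proof.
elim: m i x => [|m IH] i x /=.
  rewrite (big_pred1 [tuple]) => [|t]; first by rewrite big_ord0.
  by rewrite [t]tuple0 /= eqxx.
rewrite (reindex (fun p : 'I_3 * m.-tuple 'I_3 => [tuple of p.1 :: p.2])) /=; last first.
  exists (fun t : m.+1.-tuple 'I_3 => (thead t, [tuple of behead t])) => [[j t]|t] _ /=.
    by rewrite theadE; congr pair; apply/val_inj.
  by rewrite [t in RHS]tuple_eta.
rewrite -(pair_big_dep (fun j : 'I_3 => (i <= j)%N)
  (fun j (t : m.-tuple 'I_3) => path leq j (map val t))
  (fun j t => \prod_(k < m.+1) b (tnth [tuple of j :: t] k) (iter k step x))) /=.
apply: eq_bigr => j _; rewrite -IH big_distrr /=; apply: eq_bigr => t _.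
rewrite big_ord_recl tnth0; congr (_ * _); apply: eq_bigr => k _.
by rewrite tnthS -iterSr.
Qed.

Lemma row_sumS m i x :
  row_sum m.+1 i x = \sum_(j < 3 | (i <= j)%N) b j x * row_sum m j (step x).
Proof. by []. Qed.

End RowSum.

(** * Identities between 14-periodic sequences *)

Lemma mod14 (F : Type) (g : int -> F) : (forall k, g (k + 14) = g k) ->
  forall k a c, (a %% 14)%Z = c -> g (k + a) = g (k + c).
Proof.
move=> g14 k a _ <-; rewrite {1}(divz_eq a 14) addrA.
have gP n : g (k + n%:Z * 14 + (a %% 14)%Z) = g (k + (a %% 14)%Z).
  elim: n => [|n IH]; first by rewrite mul0r addr0.
  by rewrite -IH -[RHS]g14; congr g; rewrite -natr1; ring.
have gN n : g (k - n%:Z * 14 + (a %% 14)%Z) = g (k + (a %% 14)%Z).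
  elim: n => [|n IH]; first by rewrite mul0r subr0.
  by rewrite -IH -[LHS]g14; congr g; rewrite -natr1; ring.
rewrite addrAC; case: (a %/ 14)%Z => n; rewrite addrAC; first exact: gP.
by rewrite NegzE mulNr gN.
Qed.

Lemma shift_offset (k j a b : int) : j = k + a -> j + b = k + (a + b).
Proof. by move=> ->; rewrite addrA. Qed.

Lemma mod14_offset (F : fieldType) (g : int -> F) (k i a c : int) :
  (forall k, g (k + 14) = g k) -> i = k + a -> (a %% 14)%Z = c -> g i = g (k + c).
Proof. by move=> g14 -> /(mod14 g14 k). Qed.

(* [reduce_index g g14 k] rewrites every [g (k + a1 + ... + an)] with closed [ai]
   into [g (k + c)] with [0 <= c < 14]. *)
Ltac offset k i :=
  lazymatch i with
  | k => constr:(esym (addr0 k))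
  | ?j + ?b => let p := offset k j in constr:(shift_offset b p)
  end.

Ltac reduce_index g g14 k :=
  repeat match goal with
  | |- context [g ?i] =>
    let p := offset k i in
    lazymatch type of p with _ = k + ?a =>
      let c := eval vm_compute in (a %% 14)%Z in
      first [constr_eq i (k + c); fail 1 |
        rewrite (mod14_offset g14 p (erefl c : (a %% 14)%Z = c))]
    end
  end.

Section SevenPeriodic.
Variables (F : fieldType) (w : F) (f Q : int -> F).
Hypotheses (w7 : w ^+ 7 = -1) (nz2 : 2 != 0 :> F).
Hypotheses (f14 : forall k, f (k + 14) = f k) (Q14 : forall k, Q (k + 14) = Q k).
Hypotheses (f_neq0 : forall k, f k != 0) (Q_neq0 : forall k, Q k != 0).

Lemma w_neq0 : w != 0.
Proof. by apply/eqP => w0; have /eqP := w7; rewrite w0 expr0n /= eq_sym oppr_eq0 oner_eq0. Qed.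

(* From here on [f k], [Q k], ... are the values at the k-th quarter step, so that
   the steps [i], [2 i] and the period [7/2 i] become 4, 8 and 14. *)
Definition qbox (j : 'I_3) (k : int) : F :=
  nth 0 [:: w * f (k + 6) * f (k + 2) * (Q (k - 10) / Q (k - 2));
            f (k + 6) * f (k - 6) * (Q (k - 6) * Q (k + 6) / (Q (k - 2) * Q (k + 2)));
            w^-1 * f (k - 6) * f (k - 2) * (Q (k + 10) / Q (k + 2))] j.

Definition qrow := row_sum (fun k : int => k + 8) qbox.

(** In the gauge of the header, [rho (k + 8 n)] is w^(7-n) (z_(n+1) - z_n). The sums below, weighted
    by powers of w, are therefore sums of increments of z. *)
Definition rho (k : int) : F := f k * Q k / (Q (k - 4) * Q (k + 4)).

(* [rho_sum1 m y] is the sum of [w ^+ b * rho (y + 8 b - 2)] over [b <= m], and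
   [rho_sum2 m y] that of [w ^+ (a + b) * rho (y + 8 a - 6) * rho (y + 8 b - 2)]
   over [a <= b <= m]; [a] and [b] are the positions where the label changes. *)
Fixpoint rho_sum1 (m : nat) (y : int) : F :=
  rho (y - 2) + if m is m'.+1 then w * rho_sum1 m' (y + 8) else 0.

Fixpoint rho_sum2 (m : nat) (y : int) : F :=
  rho (y - 6) * rho_sum1 m y + if m is m'.+1 then w ^+ 2 * rho_sum2 m' (y + 8) else 0.

(** The factors other than Q of a row of [m] third boxes, which serve as common prefactor of all the
    rows below. *)
Fixpoint qnorm (m : nat) (y : int) : F :=
  if m is m'.+1 then w^-1 * f (y - 6) * f (y - 2) * qnorm m' (y + 8) else 1.

(** Only the third box is left, and its quotients [Q (k + 10) / Q (k + 2)] telescope because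
    consecutive boxes are 8 apart. *)
Lemma qrow2E m y : qrow m 2 y = qnorm m y * (Q (y + 8 * m%:Z + 2) / Q (y + 2)).
Proof.
elim: m y => [|m IH] y; first by rewrite /= mulr0 addr0 mul1r divff.
rewrite /qrow row_sumS -/qrow big_mkcond !big_ord_recl big_ord0 /= !add0r addr0.
rewrite -/qrow IH /qbox /=.
have -> : y + 8 + 2 = y + 10 by ring.
have -> : y + 8 + 8 * m%:Z + 2 = y + 8 * m.+1%:Z + 2 by rewrite -natr1; ring.
by field; rewrite !Q_neq0 w_neq0.
Qed.

(** If the row starts with the third box, it consists of third boxes and contributes [rho (y - 2)].
    If it starts with the second, the label change moves one box on, at the cost of a factor w. *)
Lemma qrow1E m y : qrow m 1 y =
  qnorm m y * (Q (y + 8 * m%:Z + 2) * Q (y - 6) / (f (y - 2) * Q (y - 2)))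
  * rho_sum1 m y.
Proof.
have E1 : y - 2 - 4 = y - 6 by ring.
have E2 : y - 2 + 4 = y + 2 by ring.
elim: m y E1 E2 => [|m IH] y E1 E2.
  rewrite /= /rho mulr0 !addr0 mul1r E1 E2.
  by field; rewrite !Q_neq0 f_neq0.
rewrite /qrow row_sumS -/qrow big_mkcond !big_ord_recl big_ord0 /= !add0r addr0.
rewrite -/qrow IH; [|ring..].
rewrite qrow2E /qbox /= /rho E1 E2.
have -> : y + 8 + 8 * m%:Z + 2 = y + 8 * m.+1%:Z + 2 by rewrite -natr1; ring.
have -> : y + 8 + 2 = y + 10 by ring.
have -> : y + 8 - 2 = y + 6 by ring.
have -> : y + 8 - 6 = y + 2 by ring.
by field; rewrite !Q_neq0 !f_neq0 w_neq0.
Qed.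

(** Rows starting with the second or third box have their first label change at once and contribute
    [rho (y - 6) * rho_sum1 m y]. A leading first box moves both label changes one box on, whence
    the factor w^2. *)
Lemma qrow0E m y : qrow m 0 y =
  qnorm m y * (Q (y + 8 * m%:Z + 2) * Q (y - 10) / (f (y - 6) * f (y - 2)))
  * rho_sum2 m y.
Proof.
have E1 : y - 2 - 4 = y - 6 by ring.
have E2 : y - 2 + 4 = y + 2 by ring.
have E3 : y - 6 - 4 = y - 10 by ring.
have E4 : y - 6 + 4 = y - 2 by ring.
elim: m y E1 E2 E3 E4 => [|m IH] y E1 E2 E3 E4.
  rewrite /= /rho mulr0 !addr0 mul1r E1 E2 E3 E4.
  by field; rewrite !Q_neq0 !f_neq0.
rewrite /qrow row_sumS -/qrow big_mkcond !big_ord_recl big_ord0 /= addr0.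
rewrite -/qrow IH; [|ring..].
rewrite qrow2E qrow1E /qbox /= /rho E1 E2 E3 E4.
have -> : y + 8 + 8 * m%:Z + 2 = y + 8 * m.+1%:Z + 2 by rewrite -natr1; ring.
have -> : y + 8 + 2 = y + 10 by ring.
have -> : y + 8 - 2 = y + 6 by ring.
have -> : y + 8 - 6 = y + 2 by ring.
have -> : y + 8 - 10 = y - 2 by ring.
by field; rewrite !Q_neq0 !f_neq0 w_neq0.
Qed.

Definition qfnorm (m : nat) (k : int) : F :=
  \prod_(1 <= j < m) (f (k + (4 * m%:Z - 2 - 4 * j%:Z)) * f (k - (4 * m%:Z - 2 - 4 * j%:Z))).

Definition qT (m : nat) (k : int) : F :=
  (qfnorm m k)^-1 * qrow m 0 (k + (4 - 4 * m%:Z)).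

(** * The function T^(1) along the lattice and its linear recursion *)

Definition qt (k : int) : F :=
  1 / 2 *
  (w ^+ 3 * f (k + 3) * (Q (k + 3) / Q (k - 1))
   + w ^+ 2 * f (k - 5) * (Q (k - 5) * Q (k - 7) / (Q (k - 1) * Q (k + 5)))
   + w * f (k + 1) * (Q (k + 1) * Q (k - 7) / (Q (k - 3) * Q (k + 5)))
   + f (k - 7) * (Q (k - 7) ^+ 2 / (Q (k - 3) * Q (k + 3)))
   + w ^- 1 * f (k - 1) * (Q (k - 1) * Q (k + 7) / (Q (k + 3) * Q (k - 5)))
   + w ^- 2 * f (k + 5) * (Q (k + 5) * Q (k + 7) / (Q (k + 1) * Q (k - 5)))
   + w ^- 3 * f (k - 3) * (Q (k - 3) / Q (k + 1))).

Local Notation t := qt.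

Lemma qt14 k : t (k + 14) = t k.
Proof. by rewrite /qt; reduce_index f f14 k; reduce_index Q Q14 k. Qed.

(** By periodicity, the last six terms of the first product are the first six of the second and
    cancel. The two remaining terms are equal because w^7 = -1, and their sum absorbs the factor
    1/2. *)
Lemma qt_rec k :
  w ^+ 3 * f k * Q k = t (k - 3) * Q (k - 4) - w^-1 * Q (k + 4) * t (k + 3).
Proof.
rewrite /qt.
reduce_index f f14 k; reduce_index Q Q14 k.
by field: w7; rewrite !Q_neq0 w_neq0 nz2.
Qed.

(* Only [q 0], ..., [q 6] and [z 0], ..., [z 6] matter; the wrap-around sign of the
   antiperiodic sequences of the header is written out. *)
Definition gauged (k : int) (q z : nat -> F) : Prop :=
  [/\ forall n, q n != 0,
   [/\ Q (k + 0%Z) = q 0%N, Q (k + 8%Z) = w * q 1%N, Q (k + 2%Z) = w ^+ 2 * q 2%N,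
       Q (k + 10%Z) = w ^+ 3 * q 3%N & Q (k + 4%Z) = w ^+ 4 * q 4%N /\
       Q (k + 12%Z) = w ^+ 5 * q 5%N /\ Q (k + 6%Z) = w ^+ 6 * q 6%N],
   [/\ t (k + 3%Z) = z 0%N * q 3%N, t (k + 11%Z) = z 1%N * q 4%N,
       t (k + 5%Z) = z 2%N * q 5%N, t (k + 13%Z) = z 3%N * q 6%N &
       t (k + 7%Z) = - z 4%N * q 0%N /\ t (k + 1%Z) = - z 5%N * q 1%N /\
       t (k + 9%Z) = - z 6%N * q 2%N]
 & [/\ f (k + 0%Z) = (z 1%N - z 0%N) * q 3%N * q 4%N / q 0%N,
       f (k + 8%Z) = (z 2%N - z 1%N) * q 4%N * q 5%N / q 1%N,
       f (k + 2%Z) = (z 3%N - z 2%N) * q 5%N * q 6%N / q 2%N,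
       f (k + 10%Z) = - (z 4%N - z 3%N) * q 6%N * q 0%N / q 3%N &
       f (k + 4%Z) = (z 5%N - z 4%N) * q 0%N * q 1%N / q 4%N /\
       f (k + 12%Z) = (z 6%N - z 5%N) * q 1%N * q 2%N / q 5%N /\
       f (k + 6%Z) = (- z 0%N - z 6%N) * q 2%N * q 3%N / q 6%N]].

Lemma gauge k : exists q z, gauged k q z.
Proof.
have wX n : w ^+ n != 0 by rewrite expf_neq0 ?w_neq0.
pose q n := Q (k + (8 * n%:Z %% 14)%Z) / w ^+ n.
(* As 56 is a multiple of 14 and w^7 = -1, [q] changes sign under n -> n + 7; for n >= 4 the index n
   + 3 is brought back to n - 4 with this sign. *)
pose z n := if (n < 4)%N then t (k + ((8 * n%:Z + 3) %% 14)%Z) / q (n + 3)%N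
            else - t (k + ((8 * n%:Z + 3) %% 14)%Z) / q (n - 4)%N.
have q0 n : q n != 0 by rewrite mulf_neq0 ?invr_eq0.
have HQ n c : (8 * n%:Z %% 14)%Z = c -> Q (k + c) = w ^+ n * q n.
  by move=> <-; rewrite /q mulrCA divff ?mulr1.
have Ht n c : (n < 4)%N -> ((8 * n%:Z + 3) %% 14)%Z = c -> t (k + c) = z n * q (n + 3)%N.
  by move=> n4 <-; rewrite /z n4 divfK.
have Ht' n c : (4 <= n)%N -> ((8 * n%:Z + 3) %% 14)%Z = c -> t (k + c) = - z n * q (n - 4)%N.
  by move=> n4 <-; rewrite /z ltnNge n4 /= mulNr divfK ?opprK.
have Q0 : Q (k + 0%Z) = q 0%N by rewrite (HQ 0 0) // expr0 mul1r.
have Q8 : Q (k + 8%Z) = w * q 1%N by rewrite (HQ 1 8).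
have Q2 : Q (k + 2%Z) = w ^+ 2 * q 2%N by rewrite (HQ 2 2).
have Q10 : Q (k + 10%Z) = w ^+ 3 * q 3%N by rewrite (HQ 3 10).
have Q4 : Q (k + 4%Z) = w ^+ 4 * q 4%N by rewrite (HQ 4 4).
have Q12 : Q (k + 12%Z) = w ^+ 5 * q 5%N by rewrite (HQ 5 12).
have Q6 : Q (k + 6%Z) = w ^+ 6 * q 6%N by rewrite (HQ 6 6).
have t3 : t (k + 3%Z) = z 0%N * q 3%N by rewrite (Ht 0 3).
have t11 : t (k + 11%Z) = z 1%N * q 4%N by rewrite (Ht 1 11).
have t5 : t (k + 5%Z) = z 2%N * q 5%N by rewrite (Ht 2 5).
have t13 : t (k + 13%Z) = z 3%N * q 6%N by rewrite (Ht 3 13).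
have t7 : t (k + 7%Z) = - z 4%N * q 0%N by rewrite (Ht' 4 7).
have t1 : t (k + 1%Z) = - z 5%N * q 1%N by rewrite (Ht' 5 1).
have t9 : t (k + 9%Z) = - z 6%N * q 2%N by rewrite (Ht' 6 9).
(* The recursion solved for [f] determines all its values from those of [t] and [Q]. *)
have Hf c : f (k + c) = w ^- 3 / Q (k + c) *
  (t (k + c - 3) * Q (k + c - 4) - w^-1 * Q (k + c + 4) * t (k + c + 3)).
  by rewrite -qt_rec; field; rewrite Q_neq0 w_neq0.
clearbody q z.
exists q, z; split=> //; split=> //.
all: try split; try split.
all: rewrite Hf; reduce_index qt qt14 k; reduce_index Q Q14 k.
all: rewrite ?(t1, t3, t5, t7, t9, t11, t13) ?(Q0, Q2, Q4, Q6, Q8, Q10, Q12).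
all: by field: w7; rewrite !q0 w_neq0.
Qed.

(** The form of the header with indices reduced below 7: z_7, z_8, z_9 are - z_0, - z_1, - z_2. *)
Definition orth (z : nat -> F) : F :=
  z 0%N * z 3%N + z 1%N * z 4%N + z 2%N * z 5%N + z 3%N * z 6%N
  - z 4%N * z 0%N - z 5%N * z 1%N - z 6%N * z 2%N.

Lemma rho14 k : rho (k + 14) = rho k.
Proof. by rewrite /rho; reduce_index f f14 k; reduce_index Q Q14 k. Qed.

(** Once the denominators of [qrow0E] are divided out, the factors [f] left in [qnorm] are exactly
    those of [qfnorm]. Only Q and [rho] survive. *)
Lemma qT5E k : qT 5 k =
  w ^- 5 * Q (k + 26) * Q (k - 26) * rho_sum2 5 (k - 16).
Proof.
rewrite /qT qrow0E (_ : k + (4 - 4 * 5%:Z) = k - 16) // /qfnorm.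
move: (rho_sum2 _ _) => X; rewrite /= unlock /=.
reduce_index f f14 k; reduce_index Q Q14 k.
by field; rewrite !f_neq0 w_neq0.
Qed.

Lemma qT6E k : qT 6 k =
  w ^- 6 * Q (k + 30) * Q (k - 30) * rho_sum2 6 (k - 20).
Proof.
rewrite /qT qrow0E (_ : k + (4 - 4 * 6%:Z) = k - 20) // /qfnorm.
move: (rho_sum2 _ _) => X; rewrite /= unlock /=.
reduce_index f f14 k; reduce_index Q Q14 k.
by field; rewrite !f_neq0 w_neq0.
Qed.

Lemma gauged_orth k q z : gauged k q z -> qT 5 k = qT 6 k -> orth z = 0.
Proof.
move=> [q0 [Q0 Q8 Q2 Q10 [Q4 [Q12 Q6]]] _ [f0 f8 f2 f10 [f4 [f12 f6]]]].
have r0 : rho (k + 0%Z) = - (z 1%N - z 0%N).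
  rewrite /rho; reduce_index f f14 k; reduce_index Q Q14 k.
  by rewrite f0 Q0 Q4 Q10; field: w7; rewrite !q0 w_neq0.
have r8 : rho (k + 8%Z) = w ^+ 6 * (z 2%N - z 1%N).
  rewrite /rho; reduce_index f f14 k; reduce_index Q Q14 k.
  by rewrite f8 Q8 Q12 Q4; field: w7; rewrite !q0 w_neq0.
have r2 : rho (k + 2%Z) = w ^+ 5 * (z 3%N - z 2%N).
  rewrite /rho; reduce_index f f14 k; reduce_index Q Q14 k.
  by rewrite f2 Q2 Q12 Q6; field: w7; rewrite !q0 w_neq0.
have r10 : rho (k + 10%Z) = w ^+ 4 * (z 4%N - z 3%N).
  rewrite /rho; reduce_index f f14 k; reduce_index Q Q14 k.
  by rewrite f10 Q10 Q0 Q6; field: w7; rewrite !q0 w_neq0.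
have r4 : rho (k + 4%Z) = w ^+ 3 * (z 5%N - z 4%N).
  rewrite /rho; reduce_index f f14 k; reduce_index Q Q14 k.
  by rewrite f4 Q4 Q0 Q8; field: w7; rewrite !q0 w_neq0.
have r12 : rho (k + 12%Z) = w ^+ 2 * (z 6%N - z 5%N).
  rewrite /rho; reduce_index f f14 k; reduce_index Q Q14 k.
  by rewrite f12 Q12 Q2 Q8; field: w7; rewrite !q0 w_neq0.
have r6 : rho (k + 6%Z) = w * (- z 0%N - z 6%N).
  rewrite /rho; reduce_index f f14 k; reduce_index Q Q14 k.
  by rewrite f6 Q6 Q2 Q10; field: w7; rewrite !q0 w_neq0.
(* Modulo 14, both k + 26, k - 26 and k + 30, k - 30 are k + 2 and k + 12 in some order, so T_5 and
   T_6 share the prefactor w^7 q_2 q_5 = - q_2 q_5. *)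
have orthE : qT 6 k - qT 5 k = 4 * (q 2%N * q 5%N) * orth z.
  rewrite qT5E qT6E /=.
  reduce_index Q Q14 k; reduce_index rho rho14 k.
  rewrite r0 r2 r4 r6 r8 r10 r12 Q2 Q12 /orth.
  by field: w7; rewrite w_neq0.
move=> E; apply/eqP; have /eqP := orthE; rewrite E subrr eq_sym !mulf_eq0.
by rewrite !(negPf (q0 _)) (_ : 4 = 2 * 2 :> F) ?mulf_eq0 ?(negPf nz2) //; ring.
Qed.

(** Eliminates the boxes of T_1 in favour of T^(1). *)
Lemma orth_qs k q z : gauged k q z -> orth z = 0 ->
  t (k - 3) * t (k + 3) = \sum_(j < 3) qbox j k + f k * t (k + 7).
Proof.
move=> [q0 [Q0 Q8 Q2 Q10 [Q4 [Q12 Q6]]]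
  [t3 t11 t5 t13 [t7 [t1 t9]]] [f0 f8 f2 f10 [f4 [f12 f6]]]] R0.
rewrite !big_ord_recl big_ord0 addr0 /qbox /=.
(* The two sides differ by exactly q_3 q_4 times the quadratic form. The 0 on the right is rewritten
   as this multiple, which leaves a rational identity; the next two lemmas proceed alike with other
   cofactors. *)
apply/eqP; rewrite -subr_eq0 -[X in _ == X](mulr0 (q 3%N * q 4%N)) -R0 /orth; apply/eqP.
reduce_index f f14 k; reduce_index Q Q14 k; reduce_index qt qt14 k.
rewrite ?(t1, t3, t5, t7, t9, t11, t13) ?(Q0, Q2, Q4, Q6, Q8, Q10, Q12)
  ?(f0, f2, f4, f6, f8, f10, f12).
by field: w7; rewrite !q0 w_neq0.
Qed.

(** The relation among the values of T^(1) on which the fusion of T^(3) rests. *)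
Lemma orth_cubic k q z : gauged k q z -> orth z = 0 ->
  (t (k - 1) * t (k + 1) - f (k - 2) * f (k + 2)) * t (k + 7) =
  f (k + 4) * t (k - 1) * t (k - 3) + f (k - 4) * t (k + 1) * t (k + 3)
   - f k * f (k + 4) * f (k - 4).
Proof.
move=> [q0 [Q0 Q8 Q2 Q10 [Q4 [Q12 Q6]]]
  [t3 t11 t5 t13 [t7 [t1 t9]]] [f0 f8 f2 f10 [f4 [f12 f6]]]] R0.
apply/eqP; rewrite -subr_eq0 -[X in _ == X](mulr0 (q 0%N * q 1%N * q 6%N * z 4%N)).
rewrite -R0 /orth; apply/eqP.
reduce_index f f14 k; reduce_index qt qt14 k.
rewrite ?(t1, t3, t5, t7, t9, t11, t13) ?(f0, f2, f4, f6, f8, f10, f12).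
by field; rewrite !q0.
Qed.

(** Taken at k + 7, it exhibits the numerator of T^(3) as a multiple of phi, with a cubic polynomial
    in T^(1) as quotient. *)
Lemma orth_quartic k q z : gauged k q z -> orth z = 0 ->
  f k * (t (k + 5) * t (k + 7) * t (k - 5) - f (k + 4) * f (k - 6) * t (k - 5)
         - f (k - 4) * f (k + 6) * t (k + 5)) =
  (t (k + 5) * t (k + 11) - f (k + 8) * t (k + 1)) *
  (t (k + 3) * t (k + 9) - f (k + 6) * t (k + 13))
   - f (k + 2) * f (k + 6) * f (k - 6) * f (k - 2).
Proof.
move=> [q0 [Q0 Q8 Q2 Q10 [Q4 [Q12 Q6]]]
  [t3 t11 t5 t13 [t7 [t1 t9]]] [f0 f8 f2 f10 [f4 [f12 f6]]]] R0.
apply/eqP; rewrite -subr_eq0 -[X in _ == X](mulr0 (q 2%N * q 3%N * q 4%N * q 5%N *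
  (z 1%N * z 6%N - z 2%N * z 6%N - z 0%N * z 2%N))) -R0 /orth; apply/eqP.
reduce_index f f14 k; reduce_index qt qt14 k.
rewrite ?(t1, t3, t5, t7, t9, t11, t13) ?(f0, f2, f4, f6, f8, f10, f12).
by field; rewrite !q0.
Qed.

(** * Fusion relations along the lattice *)

Hypothesis qT56 : forall k, qT 5 k = qT 6 k.

Definition qs (k : int) : F := \sum_(j < 3) qbox j k.
Definition qt2 k : F := t (k - 1) * t (k + 1) - f (k + 2) * f (k - 2).
Definition qt3 k : F :=
  (f (k + 7))^-1 *
  (qs (k - 1) * qs (k + 1) - f (k + 5) * f (k + 1) * (f (k - 1) * f (k - 5))).

Lemma qsE k : qs k = t (k - 3) * t (k + 3) - f k * t (k + 7).
Proof.
have [q [z g]] := gauge k.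
by rewrite (orth_qs g (gauged_orth g (qT56 k))) addrK.
Qed.

Lemma qt3E k : qt3 k = t (k - 2) * t k * t (k + 2) - f (k - 3) * f (k + 1) * t (k + 2)
  - f (k - 1) * f (k + 3) * t (k - 2).
Proof.
have [q [z g]] := gauge (k + 7).
have := orth_quartic g (gauged_orth g (qT56 _)).
rewrite /qt3 !qsE; reduce_index f f14 k; reduce_index qt qt14 k => E.
apply: (mulfI (f_neq0 (k + 7%Z))); rewrite mulVKf //.
by apply: etrans (etrans (esym E) _); ring.
Qed.

(** With T^(3) in the cubic form of [qt3E], both sides agree as polynomials in [t] and [f], without
    further use of the quadratic form. *)
Lemma qt2_fusion k :
  qt2 (k - 1) * qt2 (k + 1) = f (k + 3) * f (k - 1) * (f (k + 1) * f (k - 3)) + t k * qt3 k.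
Proof.
rewrite /qt2 qt3E; reduce_index f f14 k; reduce_index qt qt14 k.
by ring.
Qed.

Lemma qt3_fusion k :
  qt3 (k - 1) * qt3 (k + 1) =
  f (k + 2) * f (k - 2) * (f (k + 4) * f k * (f k * f (k - 4))) + qt2 k ^+ 2 * qs k.
Proof.
have [q [z g]] := gauge k.
have := orth_cubic g (gauged_orth g (qT56 _)).
rewrite /qt2 !qt3E qsE; reduce_index f f14 k; reduce_index qt qt14 k => E.
move/eqP: E; rewrite -subr_eq0 => /eqP E.
(* The two sides differ by the cubic relation multiplied by [f k * qt2 k]. *)
rewrite -[RHS]addr0 -(mulr0 (f (k + 0%Z) *
  (t (k + 13%Z) * t (k + 1%Z) - f (k + 12%Z) * f (k + 2%Z)))) -E.
by ring.
Qed.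

End SevenPeriodic.

(** * Infinite products *)

Section ComplexNorm.
Variable R : realType.
Implicit Types z : R[i].

Lemma normc_ge0 z : 0 <= normc z.
Proof. by case: z => a b; rewrite /= sqrtr_ge0. Qed.

Lemma normc_gt0 z : z != 0 -> 0 < normc z.
Proof.
by move=> z0; rewrite lt_neqAle normc_ge0 andbT; apply: contra z0 => /eqP/esym/eq0_normc ->.
Qed.

Lemma Re_le_normc z : `|complex.Re z| <= normc z.
Proof. by case: z => a b; rewrite /= -sqrtr_sqr ler_wsqrtr // lerDl sqr_ge0. Qed.

Lemma Im_le_normc z : `|complex.Im z| <= normc z.
Proof. by case: z => a b; rewrite /= -sqrtr_sqr ler_wsqrtr // lerDr sqr_ge0. Qed.

Lemma normc_le z : normc z <= `|complex.Re z| + `|complex.Im z|.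
Proof.
case: z => a b /=; rewrite -[leRHS]ger0_norm ?addr_ge0 // -sqrtr_sqr ler_wsqrtr //.
rewrite sqrrD !real_normK ?num_real // addrAC lerDl.
by rewrite pmulrn_lge0 // mulr_ge0.
Qed.

Lemma normcB_ge z1 z2 : normc z1 - normc z2 <= normc (z1 + z2).
Proof.
rewrite lerBlDr; have := le_normcD (z1 + z2 : Rcomplex R) (- z2).
by rewrite normcN addrK.
Qed.

Lemma cvg_complex (u : nat -> (R[i] : numFieldType)) (a b : R) :
  (fun n => complex.Re (u n)) @ \oo --> a ->
  (fun n => complex.Im (u n)) @ \oo --> b ->
  u @ \oo --> (a +i* b : (R[i] : numFieldType)).
Proof.
move=> ua ub; apply/(@cvgrPdist_lt _ (R[i] : numFieldType)) => -[e e'].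
rewrite ltcE /= => /andP[/eqP -> e0].
have e2 : 0 < e / 2 by rewrite divr_gt0.
move/cvgrPdist_lt : ua => /(_ _ e2) ua; move/cvgrPdist_lt : ub => /(_ _ e2) ub.
near=> n; rewrite normc_def /= ltcR.
have -> : Num.sqrt (complex.Re ((a +i* b) - u n) ^+ 2 + complex.Im ((a +i* b) - u n) ^+ 2)
   = normc ((a +i* b) - u n) by case: (_ - _).
apply: (le_lt_trans (normc_le _)); rewrite [ltRHS]splitr.
have -> : complex.Re ((a +i* b) - u n) = a - complex.Re (u n) by case: (u n).
have -> : complex.Im ((a +i* b) - u n) = b - complex.Im (u n) by case: (u n).
by apply: ltrD; near: n.
Unshelve. all: by end_near. Qed.

End ComplexNorm.

Section InfiniteProduct.
Variables (R : realType) (a : nat -> R[i]) (C q : R).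
Hypotheses (C0 : 0 <= C) (q0 : 0 < q) (q1 : q < 1).
Hypothesis aC : forall k, normc (a k) <= C * q ^+ k.

Let P n : (R[i] : numFieldType) := \prod_(1 <= k < n.+1) (1 + a k).
(** The geometric tail C q^n + C q^(n+1) + ..., a bound for the sum of the moduli of [a k] over k >=
    n. *)
Let tail n : R := C * q ^+ n / (1 - q).

Let PS n : P n.+1 = P n * (1 + a n.+1).
Proof. by rewrite /P big_nat_recr. Qed.

Let tailS n : tail n.+1 = tail n - C * q ^+ n.
Proof. rewrite /tail exprS; field; apply/lt0r_neq0; rewrite subr_gt0; exact: q1. Qed.

Let tail_ge0 n : 0 <= tail n.
Proof.
have q0' := ltW q0; have q1' := ltW q1.
by rewrite /tail divr_ge0 ?mulr_ge0 ?exprn_ge0 ?subr_ge0.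
Qed.

Let tail_le m n : (m <= n)%N -> tail n <= tail m.
Proof.
elim: n => [|n IH]; first by rewrite leqn0 => /eqP ->.
rewrite leq_eqVlt => /predU1P[->//|/IH]; apply: le_trans.
by rewrite tailS gerBl mulr_ge0 // exprn_ge0 // ltW.
Qed.

(** Follows from 1 + x <= exp x, the exponent being the sum of C q^k over 1 <= k <= n. *)
Let P_le n : normc (P n) <= expR (tail 1 - tail n.+1).
Proof.
elim: n => [|n IH]; first by rewrite /P big_geq // subrr expR0 normc1.
rewrite PS normcM (tailS n.+1) opprB addrCA [X in expR X]addrC expRD.
apply: ler_pM (normc_ge0 _) (normc_ge0 _) IH _.
apply: le_trans (le_normcD (1 : Rcomplex R) _) _.
by rewrite normc1; apply: le_trans (expR_ge1Dx _); rewrite lerD2l.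
Qed.

Lemma normal_cvg (v : nat -> R) (M : R) : 0 <= M ->
  (forall n, `|v n.+1 - v n| <= M * q ^+ n) -> cvgn v.
Proof.
move=> M0 vM.
have -> : v = (fun n => v 0%N + series (telescope v) n).
  by apply/funext => n; exact: eq_sum_telescope.
apply: is_cvgD; first exact: is_cvg_cst.
apply: normed_cvg; apply: (@series_le_cvg _ _ (geometric M q)).
- by move=> n; exact: normr_ge0.
- by move=> n; apply: mulr_ge0 => //; rewrite exprn_ge0 // ltW.
- exact: vM.
- by apply: is_cvg_geometric_series; rewrite gtr0_norm.
Qed.

Let PB n : normc (P n.+1 - P n) <= expR (tail 1) * C * q * q ^+ n.
Proof.
rewrite PS mulrDr mulr1 addrC addKr normcM -!mulrA -exprS.
apply: ler_pM (normc_ge0 _) (normc_ge0 _) _ (aC _).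
by apply: le_trans (P_le n) _; rewrite ler_expR gerBl.
Qed.

Lemma prod_cvg : exists l : (R[i] : numFieldType), P @ \oo --> l.
Proof.
have M0 : 0 <= expR (tail 1) * C * q by have q0' := ltW q0; rewrite !mulr_ge0 ?expR_ge0.
exists (lim ((fun n => complex.Re (P n)) @ \oo) +i* lim ((fun n => complex.Im (P n)) @ \oo)).
apply: cvg_complex; apply: (normal_cvg M0) => n.
  have -> : complex.Re (P n.+1) - complex.Re (P n) = complex.Re (P n.+1 - P n).
    by case: (P n.+1) (P n) => ? ? [].
  exact: le_trans (Re_le_normc _) (PB n).
have -> : complex.Im (P n.+1) - complex.Im (P n) = complex.Im (P n.+1 - P n).
  by case: (P n.+1) (P n) => ? ? [].
exact: le_trans (Im_le_normc _) (PB n).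
Qed.

(** Past an index K whose tail is at most 1/2, the Weierstrass inequality, that the product of the 1
    - c_k is at least 1 minus the sum of the c_k, keeps the modulus of [P n] above half that of
    [P K]. *)
Lemma lim_prod_neq0 : (forall k, (0 < k)%N -> 1 + a k != 0) -> lim (P @ \oo) != 0.
Proof.
move=> a0; have [l Pl] := prod_cvg.
have -> : lim (P @ \oo) = l by apply: cvg_lim => //; exact: norm_hausdorff.
apply/eqP => l0; rewrite {}l0 in Pl.
have P0 n : P n != 0.
  elim: n => [|n IH]; first by rewrite /P big_geq // oner_eq0.
  by rewrite PS mulf_neq0 // a0.
have [K tK] : exists K, tail K.+1 <= 2^-1.
  have tail0 : tail @ \oo --> 0.
    rewrite (_ : tail = geometric (C / (1 - q)) q).
      by apply: cvg_geometric; rewrite gtr0_norm.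
    by apply/funext => n; rewrite /tail /= mulrAC.
  move/cvgrPdist_lt : tail0 => /(_ 2^-1); rewrite invr_gt0 ltr0n => /(_ isT)[K _ KP].
  exists K; have /ltW := KP K.+1 (leqnSn K).
  by rewrite /= sub0r normrN ger0_norm.
have PK n : (K <= n)%N -> normc (P K) * (1 - (tail K.+1 - tail n.+1)) <= normc (P n).
  elim: n => [|n IH]; first by rewrite leqn0 => /eqP ->; rewrite subrr subr0 mulr1.
  rewrite leq_eqVlt => /predU1P[<-|]; first by rewrite subrr subr0 mulr1.
  rewrite ltnS => Kn; have {}IH := IH Kn; rewrite PS normcM.
  have t0 : 0 <= tail n.+2 by [].
  have tn : tail n.+1 <= tail K.+1 by apply: tail_le.
  have aS : 1 - C * q ^+ n.+1 <= normc (1 + a n.+1).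
    by apply: le_trans (normcB_ge _ _); rewrite normc1 lerD2l lerN2.
  have := tailS n.+1.
  set x := tail n.+2 in t0 *; set y := tail n.+1 in tn IH *; set s := C * q ^+ n.+1 in aS * => xy.
  have := normc_ge0 (P K).
  move=> p0; have s0 : 0 <= s by rewrite mulr_ge0 // exprn_ge0 // ltW.
  have tK2 : tail K.+1 <= 1 by apply: le_trans tK _; lra.
  apply: le_trans (ler_pM _ _ IH aS); last 2 first.
  - by apply: mulr_ge0 => //; lra.
  - by lra.
  rewrite -mulrA ler_wpM2l //; nra.
have e0 : 0 < (normc (P K) / 2)%:C by rewrite ltcR divr_gt0 ?normc_gt0.
move/(@cvgrPdist_lt _ (R[i] : numFieldType)) : Pl => /(_ _ e0)[m _ mP].
have := mP (maxn m K) (leq_maxl _ _); rewrite /= sub0r normrN normc_def ltcR.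
have -> : Num.sqrt (complex.Re (P (maxn m K)) ^+ 2 + complex.Im (P (maxn m K)) ^+ 2) =
  normc (P (maxn m K)).
  by case: (P (maxn m K)).
apply/negP; rewrite -leNgt; apply: le_trans (PK _ (leq_maxr _ _)).
rewrite ler_pM2l ?normc_gt0 // lerBrDr -lerBrDl.
have := tail_ge0 (maxn m K).+1; lra.
Qed.
End InfiniteProduct.

(** * Zeros of the theta function *)

Section ComplexExponential.
Variable R : realType.
Implicit Types z : R[i].

Lemma cexp0 : cexp (0 : R[i]) = 1.
Proof. by rewrite /cexp /= expR0 cos0 sin0 mul1r. Qed.

Lemma cexpD z1 z2 : cexp (z1 + z2) = cexp z1 * cexp z2.
Proof.
case: z1 z2 => a b [c d]; rewrite /cexp /= expRD cosD sinD.
apply/eqP; rewrite eq_complex /=; apply/andP; split; apply/eqP; ring.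
Qed.

Lemma cexp_neq0 z : cexp z != 0.
Proof.
apply/eqP => z0; have := cexpD z (- z).
by rewrite z0 mul0r subrr cexp0 => /eqP; rewrite oner_eq0.
Qed.

Lemma cexpN z : cexp (- z) = (cexp z)^-1.
Proof.
apply: (mulfI (cexp_neq0 z)); rewrite -cexpD subrr cexp0 divff //.
exact: cexp_neq0.
Qed.

Lemma cexpMn z n : cexp (z *+ n) = cexp z ^+ n.
Proof. by elim: n => [|n IH]; rewrite ?mulr0n ?cexp0 // mulrS cexpD IH exprS. Qed.

Lemma cexp_ipi : cexp ('i%C * (pi : R)%:C) = -1.
Proof.
have -> : 'i%C * (pi : R)%:C = 0 +i* pi.
  by apply/eqP; rewrite eq_complex /= !mul0r mulr0 subrr mul1r add0r !eqxx.
rewrite /cexp /= expR0 mul1r cospi sinpi.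
by apply/eqP; rewrite eq_complex /= oppr0 !eqxx.
Qed.

Lemma cexp_eq_real z (r : R) : 0 < r -> cexp z = r%:C ->
  [/\ expR (complex.Re z) = r, cos (complex.Im z) = 1 & sin (complex.Im z) = 0].
Proof.
move=> r0; case: z => a b; rewrite /cexp /= => /eqP.
rewrite eq_complex /= !mul0r subr0 addr0 => /andP[/eqP Ec /eqP].
move/eqP; rewrite mulf_eq0 expR_eq0 /= => /eqP s0.
have c1 : cos b = 1.
  have := cos2Dsin2 b; rewrite s0 expr0n addr0 => /eqP.
  rewrite sqrf_eq1 => /orP[/eqP//|/eqP cN].
  by move: r0; rewrite -Ec cN mulrN1 oppr_gt0 ltNge expR_ge0.
by split=> //; rewrite -Ec c1 mulr1.
Qed.

End ComplexExponential.

Section Theta.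
Variables (R : realType) (tau : R).
Hypothesis tau_gt0 : 0 < tau.
Implicit Types z x : R[i].

Lemma csinDpi z : csin (z + pi%:C) = - csin z.
Proof.
rewrite /csin mulrDr opprD !cexpD cexp_ipi [cexp (- ('i%C * pi%:C))]cexpN cexp_ipi.
by rewrite invrN invr1 !mulrN1 -opprD mulNr.
Qed.

Lemma ccosD2pi z : ccos (2 * (z + pi%:C)) = ccos (2 * z).
Proof.
have E : cexp ('i%C * (2 * pi%:C)) = 1 :> R[i].
  by rewrite mulrCA mulr_natl cexpMn cexp_ipi expr2 mulrNN mulr1.
rewrite /ccos mulrDr mulrDr opprD !cexpD cexpN E.
by rewrite [cexp (- ('i%C * (2 * pi%:C)))]cexpN E invr1 !mulr1 -cexpN.
Qed.

Lemma theta1Dpi z : theta1 tau (z + pi%:C) = - theta1 tau z.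
Proof.
have E : theta1_factor tau (z + pi%:C) = theta1_factor tau z.
  by apply/funext => k; rewrite /theta1_factor ccosD2pi.
by rewrite /theta1 csinDpi E mulrN mulNr.
Qed.

Let q := nome tau.
Let q_gt0 : 0 < q. Proof. exact: expR_gt0. Qed.
Let q_lt1 : q < 1. Proof. by rewrite /q /nome expR_lt1 oppr_lt0. Qed.

Lemma theta1_factorE z k :
  theta1_factor tau z k =
  (1 - q%:C ^+ (2 * k) * cexp (2 * ('i%C * z))) *
  (1 - q%:C ^+ (2 * k) / cexp (2 * ('i%C * z))) * (1 - q%:C ^+ (2 * k)).
Proof.
rewrite /theta1_factor /ccos -/q (_ : 4 * k = 2 * k * 2)%N; last by rewrite mulnAC.
rewrite [_ ^+ (2 * k * 2)]exprM [X in cexp X](_ : _ = 2 * ('i%C * z)); last by rewrite mulrCA.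
rewrite ['i%C * (2 * z)]mulrCA cexpN.
move: (_ ^+ (2 * k)) (cexp _) (cexp_neq0 (2 * ('i%C * z))) => p E E0.
by field.
Qed.

Lemma theta1_factor_bound z k :
  normc (theta1_factor tau z k - 1) <= (4 * normc (ccos (2 * z)) + 3) * q ^+ k.
Proof.
rewrite /theta1_factor -/q; move: (ccos _) => c; set p := q%:C ^+ (2 * k).
(* With p of modulus at most 1, the second factor is bounded by 2|c| + 2 + 2|c| + 1, which gives the
   constant; the first one, p = q^(2k), gives q^k. *)
have -> : (1 - 2 * p * c + q%:C ^+ (4 * k)) * (1 - p) - 1 =
  p * (- (2 * c) + (p - 1) + 2 * c * p - p * p).
  rewrite (_ : 4 * k = 2 * k * 2)%N; last by rewrite mulnAC.
  by rewrite [_ ^+ (2 * k * 2)]exprM -/p; ring.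
have normp : normc p = q ^+ (2 * k).
  by rewrite /p -rmorphXn /= expr0n /= addr0 sqrtr_sqr gtr0_norm // exprn_gt0.
have p1 : normc p <= 1 by rewrite normp exprn_ile1 // ltW.
have norm2 : normc (2 : R[i]) = 2.
  by rewrite -[2 : R[i]](rmorph_nat (real_complex R)) /= expr0n /= addr0 sqrtr_sqr gtr0_norm.
rewrite normcM normp mulrC; have q0' := ltW q_gt0; have q1' := ltW q_lt1.
apply: ler_pM; rewrite ?normc_ge0 ?exprn_ge0 //.
  have tri (y1 y2 : R[i]) := le_normcD (y1 : Rcomplex R) y2.
  apply: le_trans (tri _ _) _; rewrite normcN normcM.
  apply: le_trans (lerD (tri _ _) (lexx _)) _; rewrite !normcM.
  apply: le_trans (lerD (lerD (tri _ _) (lexx _)) (lexx _)) _; rewrite normcN normcM.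
  apply: le_trans (lerD (lerD (lerD (lexx _) (tri _ _)) (lexx _)) (lexx _)) _.
  rewrite normcN normc1 norm2.
  have := normc_ge0 c; have := normc_ge0 p; move: p1.
  move: (normc p : R) (normc c : R) => x y; nra.
by rewrite ler_wiXn2l ?leq_pmull.
Qed.

(** The infinite product vanishes only if one of its factors does. A zero of the sine gives n = 0,
    and a zero of the k-th factor gives n = k or n = - k. *)
Lemma theta1_eq0 z : theta1 tau z = 0 ->
  exists n : int, cexp (2 * ('i%C * z)) = (expR (2 * tau * n%:~R))%:C.
Proof.
move=> /eqP; rewrite /theta1 -mulrA !mulf_eq0 pnatr_eq0 /=.
have -> : ((nome tau `^ 4^-1)%:C == 0 :> R[i]) = false.
  by rewrite eq_complex /= eqxx andbT gt_eqF // powR_gt0.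
have qX k : q%:C ^+ (2 * k) = (expR (2 * tau * - k%:R))%:C.
  rewrite -rmorphXn /q /nome -expRM_natr natrM; congr (expR _)%:C; ring.
case/or3P => // [/orP[|]|].
- rewrite subr_eq0 => /eqP E; exists 0.
  by rewrite mulr_natl cexpMn expr2 {1}E -cexpD addNr cexp0 mulr0 expR0.
- rewrite invr_eq0 mulf_eq0 pnatr_eq0 /= => /eqP/(congr1 (@complex.Im R)) /= /eqP.
  by rewrite oner_eq0.
move=> lim0.
have [k k0 /eqP] : exists2 k, (0 < k)%N & theta1_factor tau z k = 0.
  apply: contrapT => nex; move/eqP: lim0; apply/eqP.
  rewrite (_ : (fun n => _) =
    (fun n => \prod_(1 <= k < n.+1) (1 + (theta1_factor tau z k - 1)))); last first.
    by apply/funext => n; apply: eq_bigr => k _; rewrite addrC subrK.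
  apply: (lim_prod_neq0 _ q_gt0 q_lt1 (theta1_factor_bound z)).
    by rewrite addr_ge0 ?mulr_ge0 ?normc_ge0.
  move=> k k0; rewrite addrC subrK; apply/eqP => Fk; apply: nex; by exists k.
rewrite theta1_factorE qX !mulf_eq0 !subr_eq0 -orbA => /or3P[/eqP E|/eqP E|].
- exists k; apply: (mulfI (_ : (expR (2 * tau * - k%:R))%:C != 0)).
    by rewrite eq_complex /= expR_eq0.
  by rewrite -E -rmorphM -expRD -mulrDr addNr mulr0 expR0.
- exists (- k%:Z); rewrite rmorphN /=.
  by apply: (divIf (cexp_neq0 (2 * ('i%C * z)))); rewrite divff ?cexp_neq0.
rewrite eq_complex /= eqxx andbT => /eqP E.
have /eqP := expR_inj (etrans (esym E) (esym (@expR0 R))).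
by rewrite mulf_eq0 oppr_eq0 !pnatr_eq0 mulf_eq0 pnatr_eq0 /= !gt_eqF.
Qed.

(** The quotient of the two exponentials is a positive real exp(2 tau n). Hence the imaginary part
    of z1 - z2 is - tau n and the sine of twice its real part is 0; the two bounds then force both
    parts to vanish. *)
Lemma theta1_zeros_separated z1 z2 : theta1 tau z1 = 0 -> theta1 tau z2 = 0 ->
  `|complex.Re (z1 - z2)| < pi / 2 -> `|complex.Im (z1 - z2)| < tau -> z1 = z2.
Proof.
move=> /theta1_eq0[n1 E1] /theta1_eq0[n2 E2] dRe dIm.
have E : cexp (2 * ('i%C * (z1 - z2))) = (expR (2 * tau * (n1 - n2)%:~R))%:C.
  rewrite !mulrBr [in LHS]cexpD cexpN E1 E2 rmorphB mulrBr expRD expRN.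
  by rewrite rmorphM /= fmorphV.
have [] := cexp_eq_real (expR_gt0 _) E.
have -> : complex.Re (2 * ('i%C * (z1 - z2))) = - 2 * complex.Im (z1 - z2).
  by case: (z1 - z2) => a b /=; ring.
have -> : complex.Im (2 * ('i%C * (z1 - z2))) = 2 * complex.Re (z1 - z2).
  by case: (z1 - z2) => a b /=; ring.
move=> /expR_inj Im12 _ sin0.
have ImE : complex.Im (z1 - z2) = - (tau * (n1 - n2)%:~R) by lra.
have n12 : n1 - n2 = 0.
  move: dIm; rewrite ImE normrN normrM (gtr0_norm tau_gt0) -[ltRHS]mulr1 ltr_pM2l //.
  rewrite ltr_norml -[1 : R]/(1%:~R) -rmorphN !ltr_int.
  by case: (n1 - n2) => [[|m]|m].
have Im0 : complex.Im (z1 - z2) = 0 by rewrite ImE n12 mulr0 oppr0.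
suff Re0 : complex.Re (z1 - z2) = 0.
  apply/eqP; rewrite -subr_eq0; move: Re0 Im0; case: (z1 - z2) => a b /= -> ->.
  by rewrite eq_complex /= !eqxx.
move: dRe sin0; move: (complex.Re _) => a da sin0; apply/eqP/negPn/negP => a0.
have : 0 < sin (2 * `|a|).
  by apply: sin_gt0_pi; rewrite mulr_gt0 ?normr_gt0 //= mulrC -ltr_pdivlMr.
have [_|_] := ger0P a; first by rewrite sin0 ltxx.
by rewrite mulrN sinN sin0 oppr0 ltxx.
Qed.

(** Here i eta (7/2 i) = - pi, and theta_1 changes sign under a shift by pi. *)
Lemma h_shift_half_period x : h tau (x + 7 / 2 * 'i%C) = - h tau x.
Proof.
have ii : 'i%C ^+ 2 = -1 :> R[i] by exact: sqr_i.
have E : 'i%C * (eta R)%:C * x = 'i%C * (eta R)%:C * (x + 7 / 2 * 'i%C) + pi%:C.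
  rewrite /eta !rmorphM fmorphV !rmorph_nat.
  by field: ii.
by rewrite /h E theta1Dpi opprK.
Qed.

Lemma h_zeros_separated x1 x2 : h tau x1 = 0 -> h tau x2 = 0 ->
  eta R * normc (x1 - x2) < Num.min (pi / 2) tau -> x1 = x2.
Proof.
rewrite /h => /theta1_zeros_separated h1 /h1 {}h1; rewrite lt_min => /andP[d1 d2].
have eta0 : 0 < eta R by rewrite /eta divr_gt0 ?mulr_gt0 ?pi_gt0.
have ie0 : 'i%C * (eta R)%:C != 0 :> R[i].
  by rewrite mulf_neq0 // eq_complex /= ?eqxx ?andbT ?oner_eq0 ?andbF // gt_eqF.
apply: (mulfI ie0); apply: h1; rewrite -mulrBr.
  apply: le_lt_trans d1; rewrite (_ : complex.Re _ = - (eta R * complex.Im (x1 - x2))).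
    by rewrite normrN normrM gtr0_norm // ler_wpM2l ?Im_le_normc // ltW.
  by case: (x1 - x2) => a b /=; ring.
apply: le_lt_trans d2; rewrite (_ : complex.Im _ = eta R * complex.Re (x1 - x2)).
  by rewrite normrM gtr0_norm // ler_wpM2l ?Re_le_normc // ltW.
by case: (x1 - x2) => a b /=; ring.
Qed.

End Theta.

(** * Properties valid off a discrete set *)

Section Generic.
Variable R : realType.
Implicit Types P : R[i] -> Prop.

(** With this filter, [mero_eq f g] is the generic validity of [f x = g x]. *)
Definition generic P := forall c : (R[i] : numFieldType), \forall x \near c^', P x.

Lemma near_dnbhsP (c : (R[i] : numFieldType)) P :
  (exists2 e : R, 0 < e & forall x, x != c -> normc (x - c) < e -> P x) <->
  (\forall x \near c^', P x).
Proof.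
have normE (z : R[i]) : `|z| = (normc z)%:C by case: z.
split=> [[e e0 eP]|].
  apply/(@nbhs_normP _ (R[i] : numFieldType)); exists (e%:C); first by rewrite /= ltcR.
  by move=> x /=; rewrite distrC normE ltcR => xe xc; apply: eP.
move/(@nbhs_normP _ (R[i] : numFieldType)) => [[e e'] /=].
rewrite ltcE /= => /andP[/eqP -> e0] eP; exists e => // x xc xe.
by apply: eP => //=; rewrite distrC normE ltcR.
Qed.

Lemma generic_shift P d : generic P -> generic (fun x => P (x + d)).
Proof.
move=> gP c; have /near_dnbhsP[e e0 eP] := gP (c + d).
apply/near_dnbhsP; exists e => // x xc xe; apply: eP.
  by rewrite (inj_eq (addIr d)).
by rewrite opprD addrACA subrr addr0.
Qed.

Lemma generic_forall (I : finType) (P : I -> R[i] -> Prop) :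
  (forall i, generic (P i)) -> generic (fun x => forall i, P i x).
Proof. by move=> gP c; apply: filter_forall => i; exact: gP. Qed.

(** At most one exception lies within e/2 of a given c; if it is not c itself, its distance to c is
    a radius that excludes it. *)
Lemma generic_separated P (e : R) : 0 < e ->
  (forall x y, ~ P x -> ~ P y -> normc (x - y) < e -> x = y) -> generic P.
Proof.
move=> e0 sep c; apply/near_dnbhsP.
have e2 : 0 < e / 2 by rewrite divr_gt0.
have [[s [sc se Ps]]|nos] := pselect (exists s, [/\ s != c, normc (s - c) < e / 2 & ~ P s]).
  have d0 : 0 < normc (s - c) by rewrite normc_gt0 // subr_eq0.
  exists (normc (s - c)) => // x xc xs; apply: contrapT => Px.
  have xE : x = s.
    apply: sep => //; rewrite -(subrKA c) [ltRHS]splitr.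
    apply: le_lt_trans (le_normcD (x - c : Rcomplex R) _) _.
    by apply: ltrD; [exact: lt_trans xs se|rewrite -normcN opprB].
  by move: xs; rewrite xE ltxx.
exists (e / 2) => // x xc xe; apply: contrapT => Px; apply: nos; by exists x.
Qed.

End Generic.

(** * Generic non-vanishing and periodicity of phi and Q *)

Section GenericNonvanishing.
Variables (R : realType) (tau : R).
Hypothesis tau_gt0 : 0 < tau.

Lemma generic_h_neq0 : generic (fun x : R[i] => h tau x != 0).
Proof.
have eta0 : 0 < eta R by rewrite /eta divr_gt0 ?mulr_gt0 ?pi_gt0.
apply: (@generic_separated _ _ (Num.min (pi / 2) tau / eta R)).
  by rewrite divr_gt0 // lt_min tau_gt0 divr_gt0 ?pi_gt0.
move=> x y /negP/negPn/eqP hx /negP/negPn/eqP hy; rewrite ltr_pdivlMr // mulrC.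
exact: (h_zeros_separated tau_gt0).
Qed.

Lemma generic_Q_neq0 N (xs : 'I_N -> R[i]) : generic (fun x => Q_fun tau xs x != 0).
Proof.
have /generic_forall gh : forall j, generic (fun x => h tau (x - xs j) != 0).
  by move=> j; apply: generic_shift (- xs j) generic_h_neq0.
move=> c; apply: filterS (gh c) => x hx; apply/prodf_neq0 => j _; exact: hx.
Qed.

Lemma generic_phi_neq0 u N : h tau (2 * 'i%C) * h tau (3 * 'i%C) != 0 ->
  generic (fun x => phi_fun tau u N x != 0).
Proof.
move=> h23 c.
have g1 := generic_shift ((3 / 2 - u%:C) * 'i%C) generic_h_neq0 c.
have g2 := generic_shift (- ((3 / 2 - u%:C) * 'i%C)) generic_h_neq0 c.
apply: filterS2 g1 g2 => x h1 h2.
by rewrite /phi_fun expf_neq0 // mulf_neq0 ?invr_eq0 // mulf_neq0.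
Qed.

Lemma phi_shift_half_period u N x : phi_fun tau u N (x + 7 / 2 * 'i%C) = phi_fun tau u N x.
Proof.
rewrite /phi_fun; congr (_ ^+ _); congr (_ / _).
by rewrite !(addrAC x (7 / 2 * 'i%C)) !h_shift_half_period mulrNN.
Qed.

Lemma Q_shift_half_period N (xs : 'I_N -> R[i]) x : ~~ odd N ->
  Q_fun tau xs (x + 7 / 2 * 'i%C) = Q_fun tau xs x.
Proof.
move=> evenN; rewrite /Q_fun.
under eq_bigr do rewrite addrAC h_shift_half_period.
by rewrite prodrN card_ord -signr_odd (negPf evenN) mul1r.
Qed.
End GenericNonvanishing.

(** * Restriction to the quarter-step lattice *)

Section Lattice.
Variables (R : realType) (phi Q : R[i] -> R[i]) (x : R[i]).

(** All shifts of phi and Q in the transfer functions are multiples of i/4, so an identity at x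
    involves only these points. *)
Definition node (k : int) : R[i] := x + k%:~R / 4 * 'i%C.

Lemma nodeD k j : node (k + j) = node k + j%:~R / 4 * 'i%C.
Proof. by rewrite /node intrD !mulrDl addrA. Qed.

Lemma nodeDE k j (c : R[i]) : 4 * c = j%:~R -> node (k + j) = node k + c * 'i%C.
Proof. by move=> E; rewrite nodeD -E [4 * c]mulrC mulfK // pnatr_eq0. Qed.

Lemma nodeBE k j (c : R[i]) : 4 * c = j%:~R -> node (k - j) = node k - c * 'i%C.
Proof. by move=> E; rewrite (@nodeDE k (- j) (- c)) ?mulNr // mulrN E rmorphN. Qed.

Let f k := phi (node k).
Let q k := Q (node k).

Lemma TE1_node k : TE1 phi Q (node k) = qt (w R) f q k.
Proof.
rewrite /TE1 /qt /f /q.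
have E1 : 4 * (1 / 4) = 1%:~R :> R[i] by field.
have E3 : 4 * (3 / 4) = 3%:~R :> R[i] by field.
have E5 : 4 * (5 / 4) = 5%:~R :> R[i] by field.
have E7 : 4 * (7 / 4) = 7%:~R :> R[i] by field.
by rewrite !(nodeDE k E1, nodeDE k E3, nodeDE k E5, nodeDE k E7,
  nodeBE k E1, nodeBE k E3, nodeBE k E5, nodeBE k E7).
Qed.

Lemma box_node (j : 'I_3) k : box phi Q j (node k) = qbox (w R) f q j k.
Proof.
have E1 : 4 * (1 / 2) = 2%:~R :> R[i] by field.
have E3 : 4 * (3 / 2) = 6%:~R :> R[i] by field.
have E5 : 4 * (5 / 2) = 10%:~R :> R[i] by field.
rewrite /box /qbox /f /q; case: j => [[|[|[|//]]]] ? /=; rewrite /b1 /b2 /b3.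
all: by rewrite !(nodeDE k E1, nodeDE k E3, nodeDE k E5, nodeBE k E1, nodeBE k E3, nodeBE k E5).
Qed.

Lemma row_sum_node m i k :
  row_sum (fun y => y + 2 * 'i%C) (box phi Q) m i (node k) = qrow (w R) f q m i k.
Proof.
elim: m i k => [//|m IH] i k; rewrite /qrow !row_sumS; apply: eq_bigr => j _.
rewrite box_node; congr (_ * _); rewrite -[RHS]IH; congr row_sum.
by rewrite (@nodeDE k 8 2) // [8%:~R]mulrz_nat; ring.
Qed.

Lemma sorted_path0 (s : seq nat) : sorted leq s = path leq 0 s.
Proof. by case: s. Qed.

Lemma fnorm_node m k : fnorm phi m (node k) = qfnorm f m k.
Proof.
rewrite /fnorm /qfnorm; apply: eq_bigr => j _; rewrite /pm /f.
rewrite !['i%C * _]mulrC.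
have E : 4 * ((2 * m%:R - 1) / 2 - j%:R) = (4 * m%:Z - 2 - 4 * j%:Z)%:~R :> R[i].
  by rewrite !(rmorphB, rmorphM) /= !mulrz_nat; field.
by rewrite (nodeDE k E) (nodeBE k E).
Qed.

Lemma Tpos_node m k : Tpos phi Q m (node k) = qT (w R) f q m k.
Proof.
rewrite /Tpos /qT fnorm_node; congr (_ * _).
rewrite -row_sum_node -row_sumE; apply: eq_big => [t|t _]; first exact: sorted_path0.
apply: eq_bigr => i _; congr (box _ _ _ _).
have -> n y : iter n (fun y : R[i] => y + 2 * 'i%C) y = y + n%:R * 2 * 'i%C.
  elim: n => [|n IH]; first by rewrite /= !mul0r addr0.
  by rewrite iterS IH -natr1; ring.
(* The first box of the row sits at x + i (1 - m), that is at quarter step 4 - 4 m. *)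
rewrite (@nodeDE k (4 - 4 * m%:Z) (1 - m%:R)); first by ring.
by rewrite !(rmorphB, rmorphM) /= !mulrz_nat; ring.
Qed.

Lemma T1_node k : T phi Q 1 (node k) = qs (w R) f q k.
Proof.
rewrite -[T _ _ _ _]/(Tpos phi Q 1 (node k)) Tpos_node /qT /qs /qfnorm big_geq // invr1 mul1r addr0.
by rewrite /qrow row_sumS; apply: eq_bigr => j _; rewrite /= mulr1.
Qed.

Lemma T0_node k : T phi Q 0 (node k) = f (k + 2) * f (k - 2).
Proof.
have E : 4 * (1 / 2) = 2%:~R :> R[i] by rewrite [2%:~R]mulrz_nat; field.
by rewrite -[T _ _ _ _]/(pm phi (node k) (1 / 2)) /pm !['i%C * _]mulrC /f (nodeDE k E) (nodeBE k E).
Qed.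

Lemma TE2_node k : TE2 phi Q (node k) = qt2 (w R) f q k.
Proof.
have E1 : 4 * (1 / 4) = 1%:~R :> R[i] by field.
by rewrite /TE2 -(nodeDE k E1) -(nodeBE k E1) !TE1_node T0_node.
Qed.

Lemma pmT0_node k j c : 4 * c = j%:~R ->
  pm (T phi Q 0) (node k) c = f (k + j + 2) * f (k + j - 2) * (f (k - j + 2) * f (k - j - 2)).
Proof.
by move=> E; rewrite /pm !['i%C * _]mulrC -(nodeDE k E) -(nodeBE k E) !T0_node.
Qed.

End Lattice.

(** * Fusion relations *)

Lemma w_exp7 (R : realType) : w R ^+ 7 = -1.
Proof.
rewrite /w -cexpMn -cexp_ipi; congr cexp.
by rewrite -mulrnAr -rmorphMn /= -mulr_natr divfK // pnatr_eq0.
Qed.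

Section Periodic.
Variables (R : realType) (phi Q : R[i] -> R[i]).
Hypotheses (phiP : forall x, phi (x + 7 / 2 * 'i%C) = phi x)
           (QP : forall x, Q (x + 7 / 2 * 'i%C) = Q x).

Lemma node_shift14 (x : R[i]) k : node x (k + 14) = node x k + 7 / 2 * 'i%C.
Proof. by rewrite (@nodeDE _ x k 14 (7 / 2)) //; field. Qed.

Lemma Tpos_shift_half_period m x : Tpos phi Q m (x + 7 / 2 * 'i%C) = Tpos phi Q m x.
Proof.
have boxP j y : box phi Q j (y + 7 / 2 * 'i%C) = box phi Q j y.
  rewrite /box; case: j => [[|[|[|//]]]] ? /=;
    by rewrite ?/b1 ?/b2 ?/b3 !(addrAC y (7 / 2 * 'i%C)) !phiP !QP.
rewrite /Tpos; congr (_^-1 * _).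
  by apply: eq_bigr => j _; rewrite /pm !(addrAC x (7 / 2 * 'i%C)) !phiP.
apply: eq_bigr => s _; apply: eq_bigr => j _.
by rewrite (addrAC x (7 / 2 * 'i%C)) boxP.
Qed.

(** By periodicity only k modulo 14 matters, so a finite intersection of generic properties is
    enough. *)
Lemma generic_nodes (P : R[i] -> Prop) : (forall x, P (x + 7 / 2 * 'i%C) = P x) ->
  generic P -> generic (fun x => forall k : int, P (node x k)).
Proof.
move=> PP gP c.
have g : generic (fun x => forall n : 'I_14, P (node x n%:Z)).
  by apply: generic_forall => n; exact: generic_shift gP.
apply: filterS (g c) => x Px k.
have P14 j : P (node x (j + 14)) = P (node x j) by rewrite node_shift14 PP.
have := mod14 P14 0 (erefl (k %% 14)%Z); rewrite !add0r => ->.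
have : (k %% 14)%Z < 14 by apply: ltz_pmod.
have := modz_ge0 k (isT : 14 != 0 :> int).
by case: (k %% 14)%Z => // n _ n14; exact: (Px (Ordinal (n14 : (n < 14)%N))).
Qed.

Variable x : R[i].
Hypotheses (phi_neq0 : forall k, phi (node x k) != 0)
           (Q_neq0 : forall k, Q (node x k) != 0)
           (T56 : forall k, Tpos phi Q 5 (node x k) = Tpos phi Q 6 (node x k)).

Let f k := phi (node x k).
Let q k := Q (node x k).
Let f14 k : f (k + 14) = f k. Proof. by rewrite /f node_shift14 phiP. Qed.
Let q14 k : q (k + 14) = q k. Proof. by rewrite /q node_shift14 QP. Qed.
Let nz2 : 2 != 0 :> R[i]. Proof. by rewrite pnatr_eq0. Qed.
Let qT56 k : qT (w R) f q 5 k = qT (w R) f q 6 k.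
Proof. by rewrite -!Tpos_node. Qed.

Let quarter (n : nat) : 4 * (n%:R / 4) = n%:Z%:~R :> R[i].
Proof. by rewrite -pmulrn mulrC divfK // pnatr_eq0. Qed.

Lemma TE3_node k : TE3 phi Q (node x k) = qt3 (w R) f q k.
Proof.
rewrite /TE3 -(nodeDE x k (quarter 7)) -(nodeDE x k (quarter 1)) -(nodeBE x k (quarter 1)).
rewrite !T1_node (pmT0_node phi Q x k (quarter 3)).
have -> : k + 3 + 2 = k + 5 by ring.
have -> : k + 3 - 2 = k + 1 by ring.
have -> : k - 3 + 2 = k - 1 by ring.
by have -> : k - 3 - 2 = k - 5 by ring.
Qed.

Lemma TE2_fusion k :
  TE2 phi Q (node x k - 1 / 4 * 'i%C) * TE2 phi Q (node x k + 1 / 4 * 'i%C) =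
  pm (T phi Q 0) (node x k) (1 / 4) + TE1 phi Q (node x k) * TE3 phi Q (node x k).
Proof.
rewrite -(nodeDE x k (quarter 1)) -(nodeBE x k (quarter 1)) !TE2_node TE3_node TE1_node.
rewrite (pmT0_node phi Q x k (quarter 1)) (qt2_fusion (w_exp7 R) nz2 f14 q14) //.
have -> : k + 1 + 2 = k + 3 by ring.
have -> : k + 1 - 2 = k - 1 by ring.
have -> : k - 1 + 2 = k + 1 by ring.
by have -> : k - 1 - 2 = k - 3 by ring.
Qed.

Lemma TE3_fusion k :
  TE3 phi Q (node x k - 1 / 4 * 'i%C) * TE3 phi Q (node x k + 1 / 4 * 'i%C) =
  T phi Q 0 (node x k) * pm (T phi Q 0) (node x k) (1 / 2)
  + TE2 phi Q (node x k) ^+ 2 * TE6 phi Q (node x k).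
Proof.
have half : 4 * (1 / 2) = 2%:~R :> R[i] by field.
rewrite -(nodeDE x k (quarter 1)) -(nodeBE x k (quarter 1)) !TE3_node TE2_node /TE6 T1_node.
rewrite (pmT0_node phi Q x k half) T0_node (qt3_fusion (w_exp7 R) nz2 f14 q14) //.
have -> : k + 2 + 2 = k + 4 by ring.
have -> : k - 2 - 2 = k - 4 by ring.
by rewrite addrK subrK.
Qed.

End Periodic.

Theorem proposition2 (R : realType) (tau u : R) (N : nat) (xs : 'I_N -> R[i])
    (htau : 0 < tau) (hN0 : (0 < N)%N) (hN : ~~ odd N) :
  let phi := phi_fun tau u N in
  let Q := Q_fun tau xs in
  let T0 := T phi Q 0 in
  let T1 := TE1 phi Q in
  let T2 := TE2 phi Q in
  let T3 := TE3 phi Q in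
  let T4 := TE4 phi Q in
  let T5 := TE5 phi Q in
  let T6 := TE6 phi Q in
  bethe_equations phi Q xs ->
  largest_eigenvalue_sector phi Q ->
  mero_eq (fun x => T1 (x - 1 / 4 * 'i%C) * T1 (x + 1 / 4 * 'i%C))
          (fun x => T0 x + T2 x) /\
  mero_eq (fun x => T5 (x - 1 / 4 * 'i%C) * T5 (x + 1 / 4 * 'i%C))
          (fun x => T0 x + T4 x) /\
  mero_eq (fun x => T6 (x - 1 / 4 * 'i%C) * T6 (x + 1 / 4 * 'i%C))
          (fun x => pm T0 x (3 / 4) + phi (x + 7 / 4 * 'i%C) * T3 x) /\
  mero_eq (fun x => T2 (x - 1 / 4 * 'i%C) * T2 (x + 1 / 4 * 'i%C))
          (fun x => pm T0 x (1 / 4) + T1 x * T3 x) /\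
  mero_eq (fun x => T3 (x - 1 / 4 * 'i%C) * T3 (x + 1 / 4 * 'i%C))
          (fun x => T0 x * pm T0 x (1 / 2) + T2 x ^+ 2 * T6 x) /\
  mero_eq (fun x => T4 (x - 1 / 4 * 'i%C) * T4 (x + 1 / 4 * 'i%C))
          (fun x => pm T0 x (1 / 4) + T3 x * T5 x).
Proof.
move=> phi Q T0 T1 T2 T3 T4 T5 T6 bethe [Tsym _ _ _ _].
(* If this product were 0, division by 0 and N/2 > 0 would make phi identically 0, against the
   non-vanishing of phi(x_1 - i) in the Bethe equations. *)
have h23 : h tau (2 * 'i%C) * h tau (3 * 'i%C) != 0.
  have [phi0 _ _] := bethe (Ordinal hN0); apply: contraNneq phi0 => h23.
  have N2 : (0 < N./2)%N by rewrite half_gt0; move: hN0 hN; clear; case: N => [|[]].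
  by rewrite /phi /phi_fun h23 invr0 mulr0 expr0n eqn0Ngt N2.
have phi_neq0 := generic_phi_neq0 htau u N h23.
have Q_neq0 := generic_Q_neq0 htau xs.
have phiP x : phi (x + 7 / 2 * 'i%C) = phi x by exact: phi_shift_half_period.
have QP x : Q (x + 7 / 2 * 'i%C) = Q x by exact: Q_shift_half_period.
(* The case m = 5 of the symmetry T_m = T_(11-m). *)
have T56 : generic (fun x => Tpos phi Q 5 x = Tpos phi Q 6 x) := Tsym 5 isT.
have good : generic (fun x => forall k : int, [/\ phi (node x k) != 0, Q (node x k) != 0
    & Tpos phi Q 5 (node x k) = Tpos phi Q 6 (node x k)]).
  apply: (@generic_nodes R (fun x => [/\ phi x != 0, Q x != 0
    & Tpos phi Q 5 x = Tpos phi Q 6 x])).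
    by move=> x; rewrite phiP QP !Tpos_shift_half_period.
  by move=> c; apply: filterS3 (phi_neq0 c) (Q_neq0 c) (T56 c).
have T2E : mero_eq (fun x => T1 (x - 1 / 4 * 'i%C) * T1 (x + 1 / 4 * 'i%C))
                   (fun x => T0 x + T2 x).
  by move=> c; apply: nearW => x; rewrite /T2 /TE2 [RHS]addrC subrK.
have node0 (x : R[i]) : node x 0 = x by rewrite /node mul0r mul0r addr0.
have T22 : mero_eq (fun x => T2 (x - 1 / 4 * 'i%C) * T2 (x + 1 / 4 * 'i%C))
                   (fun x => pm T0 x (1 / 4) + T1 x * T3 x).
  move=> c; apply: filterS (good c) => x gx; have := @TE2_fusion R phi Q phiP QP x.
  move=> /(_ (fun k => let: And3 p _ _ := gx k in p) (fun k => let: And3 _ p _ := gx k in p)).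
  by move=> /(_ (fun k => let: And3 _ _ p := gx k in p) 0); rewrite node0.
split=> //; split=> //; split; [|split=> //; split].
(* This is the definition of T^(3), multiplied out where phi(x + 7/4 i) is nonzero. *)
- move=> c; apply: filterS (generic_shift (7 / 4 * 'i%C) phi_neq0 c) => x px.
  by rewrite /T3 /TE3 mulVKf // [RHS]addrC subrK.
- move=> c; apply: filterS (good c) => x gx; have := @TE3_fusion R phi Q phiP QP x.
  move=> /(_ (fun k => let: And3 p _ _ := gx k in p) (fun k => let: And3 _ p _ := gx k in p)).
  by move=> /(_ (fun k => let: And3 _ _ p := gx k in p) 0); rewrite node0.
- by move=> c; apply: filterS (T22 c) => x; rewrite [T3 x * _]mulrC.
Qed.
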